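(* Let $p$ be a program of the split fireball calculus and let $\pi \triangleright \Gamma \vdash p : M$ be a type derivation. Then there exist a normal program $q$ and an evaluation $d : p \to_{\beta_f}^* q$ such that $|d| + |q| \leq |\pi|$.
   Context: Terms: $t,u ::= x \mid \lambda x.t \mid tu$, up to $\alpha$-equivalence; $t\{x\leftarrow u\}$ is capture-avoiding substitution. Values: $v ::= x \mid \lambda x.t$. Fireballs $f$ and inert terms $i$ are defined by mutual induction: $f ::= v \mid i$ and $i ::= x f_1 \dots f_n$ with $n>0$ (application left-associative). Right evaluation contexts: $C ::= \langle\cdot\rangle \mid t\,C \mid C\,f$. Split fireball calculus: environments $E ::= \epsilon \mid [x\leftarrow i]:E$ (lists of pairs of a variable and an inert term); programs are pairs $p=(t,E)$. Reduction on programs: $(C\langle(\lambda x.t)v\rangle,E)\to_{\beta_v}(C\langle t\{x\leftarrow v\}\rangle,E)$ and $(C\langle(\lambda x.t)i\rangle,E)\to_{\beta_i}(C\langle t\rangle,[x\leftarrow i]:E)$; $\to_{\beta_f}=\to_{\beta_v}\cup\to_{\beta_i}$. A program is normal if it has no $\to_{\beta_f}$-reduct. For an evaluation $d$, $|d|$ is its number of $\to_{\beta_f}$-steps. Append: $\epsilon@[x\leftarrow i]=[x\leftarrow i]$, $([y\leftarrow i']:E)@[x\leftarrow i]=[y\leftarrow i']:(E@[x\leftarrow i])$. Sizes: $|v|=0$, $|tu|=|t|+|u|+1$, $|(t,\epsilon)|=|t|$, $|(t,E@[x\leftarrow i])|=|(t,E)|+|i|$. Multi types: linear types $L ::= M\multimap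 N$; multi types $M,N ::= [L_1,\dots,L_n]$ (finite multisets, $n\ge 0$); $\mathbf 0$ is the empty multiset and $\uplus$ is multiset sum. A type context $\Gamma$ is a total map from variables to multi types with finite $\mathrm{dom}(\Gamma)=\{x\mid \Gamma(x)\ne\mathbf 0\}$; $(\Gamma\uplus\Delta)(x)=\Gamma(x)\uplus\Delta(x)$; $x:M$ is the context mapping $x$ to $M$ and all else to $\mathbf 0$; $\Gamma,x:M$ extends $\Gamma$ (with $x\notin\mathrm{dom}(\Gamma)$) by $x\mapsto M$. Typing rules: (ax) $x:M\vdash x:M$; (@) from $\Gamma\vdash t:[M\multimap N]$ and $\Delta\vdash u:M$ infer $\Gamma\uplus\Delta\vdash tu:N$; ($\lambda$) from $\Gamma_k,x:M_k\vdash t:N_k$ for $k=1,\dots,n$ ($n\ge0$) infer $\Gamma_1\uplus\dots\uplus\Gamma_n\vdash\lambda x.t:[M_1\multimap N_1,\dots,M_n\multimap N_n]$; (es$_\epsilon$) from $\Gamma\vdash t:M$ infer $\Gamma\vdash (t,\epsilon):M$; (es$_@$) from $\Gamma,x:M\vdash(t,E):N$ and $\Delta\vdash i:M$ infer $\Gamma\uplus\Delta\vdash(t,E@[x\leftarrow i]):N$. $\pi\triangleright\Gamma\vdash e:M$ means $\pi$ is a derivation with that conclusion; $|\pi|$ is the number of (@) rules in $\pi$. *)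

(* Defs.v *)
From HB Require Import structures.
From mathcomp Require Import all_boot.
From mathcomp Require Import finmap multiset.

Set Implicit Arguments.
Unset Strict Implicit.
Unset Printing Implicit Defensive.

Local Open Scope mset_scope.
Local Open Scope nat_scope.

(* Terms up to alpha-equivalence are de Bruijn terms, with parallel renaming  *)
(* and substitution.                                                          *)
Inductive term : Type :=
| Var of nat
| Lam of term
| App of term & term.

Definition up_ren (r : nat -> nat) (x : nat) : nat :=
  if x is y.+1 then (r y).+1 else 0.

Fixpoint rename (r : nat -> nat) (t : term) : term :=
  match t with
  | Var x => Var (r x)
  | Lam t1 => Lam (rename (up_ren r) t1)
  | App t1 t2 => App (rename r t1) (rename r t2)
  end.

Definition up_subst (s : nat -> term) (x : nat) : term :=
  if x is y.+1 then rename S (s y) else Var 0.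

Fixpoint subst (s : nat -> term) (t : term) : term :=
  match t with
  | Var x => s x
  | Lam t1 => Lam (subst (up_subst s) t1)
  | App t1 t2 => App (subst s t1) (subst s t2)
  end.

(* t{x<-u}, where x is the variable of index 0 of t. *)
Definition subst0 (u t : term) : term :=
  subst (fun x => if x is y.+1 then Var y else u) t.

Definition is_value (t : term) : bool :=
  if t is App _ _ then false else true.

(* x f1 ... fn with n > 0 is built by the grammar i ::= x f | i f; see        *)
(* [is_inertP].                                                               *)
Fixpoint is_inert (t : term) : bool :=
  if t is App t1 t2 then
    (if t1 is Var _ then true else is_inert t1) && (is_value t2 || is_inert t2)
  else false.

Definition is_fireball (t : term) : bool := is_value t || is_inert t.

Lemma is_inertP (t : term) :
  reflect (exists x (fs : seq term),
             [/\ 0 < size fs, all is_fireball fs & t = foldl App (Var x) fs])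
          (is_inert t).
Proof.
apply: (iffP idP).
- elim: t => [//|//|t1 IH1 t2 _] /= /andP[H1 H2].
  case: t1 IH1 H1 => [x|//|t11 t12] IH1 H1; first by exists x, [:: t2]; rewrite /= andbT.
  have [x [fs [fs0 Hfs ->]]] := IH1 H1.
  by exists x, (rcons fs t2); rewrite size_rcons all_rcons Hfs foldl_rcons andbT.
- move=> [x [fs [fs0 Hfs ->]]] {t}.
  elim/last_ind: fs fs0 Hfs => [//|fs f IH] _.
  rewrite all_rcons foldl_rcons /= => /andP[Hf Hfs].
  apply/andP; split=> //.
  case: fs IH Hfs => [//|g gs] IH Hfs.
  by have := IH isT Hfs; case: (foldl _ _ _).
Qed.

Record inert := Inert { inert_term :> term; inertP : is_inert inert_term }.

Record fireball :=
  Fireball { fireball_term :> term; fireballP : is_fireball fireball_term }.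

Lemma is_inert_rename r t : is_inert (rename r t) = is_inert t.
Proof.
elim: t => //= t1 IH1 t2 IH2; rewrite -IH1 -IH2.
by case: t1 {IH1} => //; case: t2 {IH2}.
Qed.

Lemma is_fireball_rename r t : is_fireball (rename r t) = is_fireball t.
Proof. by rewrite /is_fireball is_inert_rename; case: t. Qed.

Lemma rename_fireball_subproof r (f : fireball) : is_fireball (rename r f).
Proof. by rewrite is_fireball_rename; apply: fireballP. Qed.

Definition rename_fireball r (f : fireball) : fireball :=
  Fireball (rename_fireball_subproof r f).

Inductive rctx : Type :=
| Hole
| CtxR of term & rctx
| CtxL of rctx & fireball.

Fixpoint plug (C : rctx) (t : term) : term :=
  match C with
  | Hole => t
  | CtxR u C1 => App u (plug C1 t)
  | CtxL C1 f => App (plug C1 t) f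
  end.

Fixpoint rename_rctx (r : nat -> nat) (C : rctx) : rctx :=
  match C with
  | Hole => Hole
  | CtxR u C1 => CtxR (rename r u) (rename_rctx r C1)
  | CtxL C1 f => CtxL (rename_rctx r C1) (rename_fireball r f)
  end.

(* The entry [x<-i] of E1 ++ [x<-i] : E2 binds x in the term of the program   *)
(* and in E1. Hence, in (t, [:: i_0; ...; i_(n-1)]), index k < n of t denotes *)
(* the variable bound by i_k, index n + k of t is the k-th free variable of   *)
(* the program, and i_j is in the scope of the entries i_(j+1), ..., i_(n-1)  *)
(* only.                                                                      *)
Definition env := seq inert.
Definition program := (term * env)%type.

Inductive step_bv : program -> program -> Prop :=
| Step_bv (C : rctx) (t v : term) (E : env) :
    is_value v ->
    step_bv (plug C (App (Lam t) v), E) (plug C (subst0 v t), E).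

(* The context C is weakened, as the bound variable of t becomes the one of   *)
(* the new head entry of the environment.                                     *)
Inductive step_bi : program -> program -> Prop :=
| Step_bi (C : rctx) (t : term) (i : inert) (E : env) :
    step_bi (plug C (App (Lam t) i), E) (plug (rename_rctx S C) t, i :: E).

Definition step_bf (p q : program) : Prop := step_bv p q \/ step_bi p q.

Definition normal (p : program) : Prop := ~ exists q, step_bf p q.

Inductive evaluation : program -> program -> Type :=
| Eval_nil p : evaluation p p
| Eval_cons p q r : step_bf p q -> evaluation q r -> evaluation p r.

Fixpoint eval_length p q (d : evaluation p q) : nat :=
  match d with
  | Eval_nil _ => 0
  | Eval_cons _ _ _ _ d1 => (eval_length d1).+1
  end.

Fixpoint term_size (t : term) : nat :=
  if t is App t1 t2 then term_size t1 + term_size t2 + 1 else 0.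

Definition program_size (p : program) : nat :=
  foldl (fun n (i : inert) => n + term_size i) (term_size p.1) p.2.

Lemma program_size_nil t : program_size (t, [::]) = term_size t.
Proof. by []. Qed.

Lemma program_size_rcons t E (i : inert) :
  program_size (t, rcons E i) = program_size (t, E) + term_size i.
Proof. by rewrite /program_size foldl_rcons. Qed.

(* Linear types must be the initial algebra of X |-> {mset X} * {mset X}; as  *)
(* {mset _} cannot occur in an inductive definition, they are built as trees  *)
(* over lists in which each list is the chosen representative of its class    *)
(* modulo permutation. The properties [arrow_inj], [arrow_surj] and           *)
(* [ltype_ind] characterize the result.                                       *)
Inductive rtype : Type := RArrow of seq rtype & seq rtype.

Definition rtype_nested_ind (P : rtype -> Prop)
    (H : forall s1 s2,
       foldr (fun r Q => P r /\ Q) True s1 ->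
       foldr (fun r Q => P r /\ Q) True s2 -> P (RArrow s1 s2)) :
    forall r, P r :=
  fix ind (r : rtype) : P r :=
    let fix all_ind s : foldr (fun r Q => P r /\ Q) True s :=
      if s is r1 :: s1 then conj (ind r1) (all_ind s1) else I in
    let: RArrow s1 s2 := r in H s1 s2 (all_ind s1) (all_ind s2).

Fixpoint rtype_encode (r : rtype) : GenTree.tree nat :=
  let: RArrow s1 s2 := r in
  GenTree.Node 0 [:: GenTree.Node 0 (map rtype_encode s1);
                     GenTree.Node 0 (map rtype_encode s2)].

Fixpoint rtype_decode (e : GenTree.tree nat) : rtype :=
  match e with
  | GenTree.Node _ [:: GenTree.Node _ s1; GenTree.Node _ s2] =>
      RArrow (map rtype_decode s1) (map rtype_decode s2)
  | _ => RArrow [::] [::]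
  end.

Lemma rtype_encodeK : cancel rtype_encode rtype_decode.
Proof.
elim/rtype_nested_ind => s1 s2 IH1 IH2 /=.
by congr RArrow; [elim: s1 IH1 | elim: s2 IH2] => //= r s IHs [-> /IHs->].
Qed.

HB.instance Definition _ := Countable.copy rtype (can_type rtype_encodeK).

Lemma rtype_ind_mem (P : rtype -> Prop) :
  (forall s1 s2, (forall r, r \in s1 -> P r) -> (forall r, r \in s2 -> P r) ->
     P (RArrow s1 s2)) -> forall r, P r.
Proof.
move=> H; elim/rtype_nested_ind => s1 s2 IH1 IH2; apply: H => r.
- elim: s1 IH1 => //= r' s IHs [Pr' /IHs Ps].
  by rewrite in_cons => /predU1P[->|/Ps].
- elim: s2 IH2 => //= r' s IHs [Pr' /IHs Ps].
  by rewrite in_cons => /predU1P[->|/Ps].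
Qed.

Definition canon_seq (s : seq rtype) : seq rtype := choose (perm_eq s) s.

Lemma perm_canon_seq s : perm_eq s (canon_seq s).
Proof. exact/chooseP/perm_refl. Qed.

Lemma eq_canon_seq s1 s2 : perm_eq s1 s2 -> canon_seq s1 = canon_seq s2.
Proof.
move=> s12; rewrite /canon_seq (@eq_choose _ (perm_eq s1) (perm_eq s2)).
  by apply: choose_id => //; rewrite perm_sym.
by apply/permPl.
Qed.

Lemma canon_seq_inj s1 s2 : canon_seq s1 = canon_seq s2 -> perm_eq s1 s2.
Proof.
move=> s12; apply: perm_trans (perm_canon_seq s1) _.
by rewrite s12 perm_sym perm_canon_seq.
Qed.

Fixpoint rnorm (r : rtype) : rtype :=
  let: RArrow s1 s2 := r in
  RArrow (canon_seq (map rnorm s1)) (canon_seq (map rnorm s2)).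

Definition is_normal_rtype (r : rtype) : bool := rnorm r == r.

Record ltype := LType { ltype_val : rtype; _ : is_normal_rtype ltype_val }.

HB.instance Definition _ := [isSub for ltype_val].
HB.instance Definition _ := [Countable of ltype by <:].

Notation mtype := {mset ltype}.

Lemma map_rnorm_id (s : seq rtype) :
  (forall r, r \in s -> rnorm r = r) -> map rnorm s = s.
Proof. by move=> H; rewrite -[RHS]map_id; apply/eq_in_map. Qed.

Lemma map_rnorm_canon_val (s : seq ltype) :
  map rnorm (canon_seq (map val s)) = canon_seq (map val s).
Proof.
apply: map_rnorm_id => r; rewrite -(perm_mem (perm_canon_seq _)).
by move=> /mapP[L _ ->]; apply/eqP/(valP L).
Qed.

Lemma canon_seqK s : canon_seq (canon_seq s) = canon_seq s.
Proof. by apply: eq_canon_seq; rewrite perm_sym perm_canon_seq. Qed.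

Lemma arrow_subproof (M N : mtype) :
  is_normal_rtype (RArrow (canon_seq (map val M)) (canon_seq (map val N))).
Proof.
by rewrite /is_normal_rtype /= !map_rnorm_canon_val !canon_seqK.
Qed.

Definition arrow (M N : mtype) : ltype := LType (arrow_subproof M N).

Notation "M --o N" := (arrow M N)
  (at level 60, right associativity, format "M  --o  N").

Lemma perm_enum_mset_eq (M N : mtype) : perm_eq M N -> M = N.
Proof. by move=> /eq_seq_msetP; rewrite !seq_mset_id. Qed.

Lemma arrow_inj (M N M' N' : mtype) :
  M --o N = M' --o N' -> M = M' /\ N = N'.
Proof.
move=> /(congr1 val) /= [] /canon_seq_inj HM /canon_seq_inj HN.
by split; apply: perm_enum_mset_eq; apply: perm_map_inj val_inj _ _ _.
Qed.

Lemma rnorm_id r : rnorm (rnorm r) = rnorm r.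
Proof.
elim/rtype_ind_mem: r => s1 s2 IH1 IH2 /=.
have key s : (forall r, r \in s -> rnorm (rnorm r) = rnorm r) ->
    canon_seq (map rnorm (canon_seq (map rnorm s))) = canon_seq (map rnorm s).
  move=> IH; rewrite map_rnorm_id ?canon_seqK // => r.
  by rewrite -(perm_mem (perm_canon_seq _)) => /mapP[r' /IH ? ->].
by rewrite !key.
Qed.

Lemma arrow_surj (L : ltype) : exists M N : mtype, L = M --o N.
Proof.
case: L => -[s1 s2] Hr; have /eqP[E1 E2] := Hr.
have ex s : canon_seq (map rnorm s) = s ->
    exists M : mtype, canon_seq (map val M) = s.
  move=> Es; have Hs r : r \in s -> is_normal_rtype r.
    rewrite -{1}Es -(perm_mem (perm_canon_seq _)) => /mapP[r' _ ->].
    by rewrite /is_normal_rtype rnorm_id.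
  have EL : map val (pmap (insub : rtype -> option ltype) s) = s.
    rewrite (pmap_filter (insubK _)).
    by apply/all_filterP/allP => r /Hs; rewrite isSome_insub.
  exists (seq_mset (pmap insub s)); rewrite -[RHS]Es.
  apply: eq_canon_seq; rewrite map_rnorm_id; last by move=> r /Hs/eqP.
  by rewrite -[X in perm_eq _ X]EL; apply/perm_map/perm_eq_seq_mset.
have [M EM] := ex _ E1; have [N EN] := ex _ E2.
by exists M, N; apply: val_inj; rewrite /= EM EN.
Qed.

Lemma ltype_ind (P : ltype -> Prop) :
  (forall M N : mtype, (forall L, L \in M -> P L) -> (forall L, L \in N -> P L) ->
     P (M --o N)) -> forall L, P L.
Proof.
move=> H L; have [r Hr] : exists r, val L = r by exists (val L).
elim/rtype_ind_mem: r L Hr => s1 s2 IH1 IH2 L.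
have [M [N ->]] := arrow_surj L => -[E1 E2].
by apply: H => L' HL'; [apply: (IH1 (val L')) | apply: (IH2 (val L'))] => //;
  rewrite -?E1 -?E2 -(perm_mem (perm_canon_seq _)); apply: map_f.
Qed.

Definition tctx := {fsfun nat -> mtype with mset0}.

Definition ctx0 : tctx := [fsfun].

Definition ctx1 (x : nat) (M : mtype) : tctx := [fsfun ctx0 with x |-> M].

Definition ctxD (G D : tctx) : tctx :=
  [fsfun x in (finsupp G `|` finsupp D)%fset => (G x `+` D x)%mset].

(* The context "G, x : M" where x is the variable of index 0. *)
Definition ctx_cons (M : mtype) (G : tctx) : tctx :=
  [fsfun x in (0 |` [fset y.+1 | y in finsupp G])%fset =>
     if x is y.+1 then G y else M].

Lemma ctx0E x : ctx0 x = mset0.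
Proof. exact: fsfun0E. Qed.

Lemma ctx1E x M y : ctx1 x M y = if y == x then M else mset0.
Proof. by rewrite fsfun_withE ctx0E. Qed.

Lemma ctxDE G D x : ctxD G D x = (G x `+` D x)%mset.
Proof.
rewrite fsfunE inE; case: (finsuppP G x) => //= _.
by case: (finsuppP D x) => //= _; rewrite msetD0.
Qed.

Lemma ctx_consE M G x : ctx_cons M G x = if x is y.+1 then G y else M.
Proof.
rewrite fsfunE; case: x => [|y]; first by rewrite !inE eqxx.
rewrite !inE /= mem_imfset /=; last by move=> ? ? [].
by case: finsuppP.
Qed.

Lemma ctxDA : associative ctxD.
Proof. by move=> G D T; apply/fsfunP => x; rewrite !ctxDE msetDA. Qed.

Lemma ctxDC : commutative ctxD.
Proof. by move=> G D; apply/fsfunP => x; rewrite !ctxDE msetDC. Qed.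

Lemma ctx0D : left_id ctx0 ctxD.
Proof. by move=> G; apply/fsfunP => x; rewrite ctxDE ctx0E msetDC msetD0. Qed.

HB.instance Definition _ := Monoid.isComLaw.Build tctx ctx0 ctxD ctxDA ctxDC ctx0D.

Lemma mset0D : left_id (mset0 : mtype) (@msetD ltype).
Proof. by move=> M; rewrite msetDC msetD0. Qed.

HB.instance Definition _ :=
  Monoid.isComLaw.Build mtype mset0 (@msetD ltype) (@msetDA ltype) (@msetDC ltype) mset0D.

Inductive derivation : tctx -> term -> mtype -> Type :=
| D_ax (x : nat) (M : mtype) : derivation (ctx1 x M) (Var x) M
| D_app (G D : tctx) (t u : term) (M N : mtype) :
    derivation G t [mset (M --o N)] -> derivation D u M ->
    derivation (ctxD G D) (App t u) N
| D_lam (n : nat) (G : 'I_n -> tctx) (M N : 'I_n -> mtype) (t : term) :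
    (forall k : 'I_n, derivation (ctx_cons (M k) (G k)) t (N k)) ->
    derivation (\big[ctxD/ctx0]_(k < n) G k) (Lam t)
               (\big[@msetD ltype/mset0]_(k < n) [mset (M k --o N k)]).

Inductive program_derivation : tctx -> program -> mtype -> Type :=
| D_es_nil (G : tctx) (t : term) (M : mtype) :
    derivation G t M -> program_derivation G (t, [::]) M
| D_es_rcons (G D : tctx) (t : term) (E : env) (i : inert) (M N : mtype) :
    program_derivation (ctx_cons M G) (t, E) N -> derivation D i M ->
    program_derivation (ctxD G D) (t, rcons E i) N.

Fixpoint derivation_size G t M (d : derivation G t M) : nat :=
  match d with
  | D_ax _ _ => 0
  | D_app _ _ _ _ _ _ d1 d2 => derivation_size d1 + derivation_size d2 + 1
  | D_lam n _ _ _ _ ds => \sum_(k < n) derivation_size (ds k)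
  end.

Fixpoint program_derivation_size G p M (d : program_derivation G p M) : nat :=
  match d with
  | D_es_nil _ _ _ d1 => derivation_size d1
  | D_es_rcons _ _ _ _ _ _ _ d1 d2 =>
      program_derivation_size d1 + derivation_size d2
  end.

(* Main.v *)
(* Quantitative subject reduction: every beta_f step lowers the number of (@)  *)
(* rules by exactly one, since the application of the contracted redex is      *)
(* erased and substituting a value splits its typing without duplicating or    *)
(* erasing any rule. Hence reduction terminates; a program without redex has a *)
(* fireball as its term, and for fireballs and environments of inert terms the *)
(* size is bounded by the number of (@) rules.                                 *)

Require Import Defs.
From mathcomp Require Import all_boot.
From mathcomp Require Import finmap multiset.

Set Implicit Arguments.
Unset Strict Implicit.
Unset Printing Implicit Defensive.

Local Open Scope mset_scope.
Local Open Scope nat_scope.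

(** The number of (@) rules is carried as an index of the judgments: [derivation_typed] and
    [program_derivation_ptyped] transfer a derivation to them at its own size. There the typing of a
    value is a sum of linear typings, and [subst_typed_vtyped] hands each of them to exactly one
    variable axiom, so sizes add up. Together with [step_bi_typed], which stores the typing of an
    argument instead of substituting it, this gives the exact decrease [step_bf_ptyped]. The final
    program is handled by [progress] and [fireball_program_size]. *)

(** * Multisets and type contexts as cancellative sums *)

Lemma ctxD0 : right_id ctx0 ctxD.
Proof. by move=> G; rewrite ctxDC ctx0D. Qed.

Lemma ctxDCA : left_commutative ctxD.
Proof. exact: Monoid.mulmCA. Qed.

Lemma ctxDAC : right_commutative ctxD.
Proof. exact: Monoid.mulmAC. Qed.

Lemma ctxD_inj G : injective (ctxD G).
Proof.
move=> D D' /fsfunP E; apply/fsfunP => x; move: (E x); rewrite !ctxDE.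
exact: (can_inj (msetDKB (G x))).
Qed.

Lemma msetD_eq0 (M N : mtype) : M `+` N = mset0 -> M = mset0 /\ N = mset0.
Proof.
move=> /msetP E; split; apply/msetP => L; move: (E L); rewrite msetE2 mset0E;
  by move=> /eqP; rewrite addn_eq0 => /andP[/eqP ? /eqP ?].
Qed.

Lemma mset1D_neq0 (L : ltype) (M : mtype) : L +` M <> mset0.
Proof. by move=> /msetP /(_ L); rewrite mset1DE eqxx mset0E. Qed.

Lemma mset_ind (P : mtype -> Prop) :
  P mset0 -> (forall L M, P M -> P (L +` M)) -> forall M, P M.
Proof.
move=> P0 PD M; rewrite -[M]seq_mset_id; elim: (EnumMset.f M) => [|L s IHs].
  rewrite (_ : seq_mset _ = mset0) //.
  by apply/msetP => L; rewrite mset_seqE mset0E.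
rewrite (_ : seq_mset _ = L +` seq_mset s); first exact: PD.
by apply/msetP => L'; rewrite mset1DE !mset_seqE /= eq_sym.
Qed.

Lemma ctxD_eq0 G D : ctxD G D = ctx0 -> G = ctx0 /\ D = ctx0.
Proof.
move=> /fsfunP E; split; apply/fsfunP => x; move: (E x); rewrite ctxDE !ctx0E;
  by case/msetD_eq0.
Qed.

Lemma ctx1D_neq0 x L G : ctxD (ctx1 x [mset L]) G <> ctx0.
Proof.
by move=> /fsfunP /(_ x); rewrite ctxDE ctx1E eqxx ctx0E; apply: mset1D_neq0.
Qed.

Lemma ctx1_0 x : ctx1 x mset0 = ctx0.
Proof. by apply/fsfunP => y; rewrite ctx1E ctx0E; case: ifP. Qed.

Lemma ctx1D x M N : ctx1 x (M `+` N) = ctxD (ctx1 x M) (ctx1 x N).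
Proof. by apply/fsfunP => y; rewrite ctxDE !ctx1E; case: ifP; rewrite ?msetD0. Qed.

Lemma ctx_cons0 : ctx_cons mset0 ctx0 = ctx0.
Proof. by apply/fsfunP => -[|x]; rewrite ctx_consE !ctx0E. Qed.

Lemma ctx_cons1 x M : ctx_cons mset0 (ctx1 x M) = ctx1 x.+1 M.
Proof. by apply/fsfunP => -[|y]; rewrite ctx_consE !ctx1E. Qed.

Lemma ctx_consD M N G D :
  ctx_cons (M `+` N) (ctxD G D) = ctxD (ctx_cons M G) (ctx_cons N D).
Proof. by apply/fsfunP => -[|x]; rewrite !(ctxDE, ctx_consE). Qed.

Lemma ctx_cons_split M G : ctx_cons M G = ctxD (ctx1 0 M) (ctx_cons mset0 G).
Proof.
by apply/fsfunP => -[|x]; rewrite ctxDE !ctx_consE ctx1E /= ?msetD0 ?mset0D.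
Qed.

(** The marked copy of [L] at [x] lies in one of the two summands and can be cancelled on both
    sides. This lets [styped_split] route each assumption to one premise. *)
Lemma ctx1_in_ctxD x L G G1 G2 : ctxD (ctx1 x [mset L]) G = ctxD G1 G2 ->
  (exists2 G', G1 = ctxD (ctx1 x [mset L]) G' & G = ctxD G' G2) \/
  (exists2 G', G2 = ctxD (ctx1 x [mset L]) G' & G = ctxD G1 G').
Proof.
have key (G' : tctx) : L \in (G' x : mtype) -> exists G'', G' = ctxD (ctx1 x [mset L]) G''.
  move=> L_in; exists [fsfun G' with x |-> G' x `\ L]; apply/fsfunP => y.
  rewrite ctxDE ctx1E fsfun_withE; case: eqP => [->|_]; last by rewrite mset0D.
  by rewrite msetB1K.
move=> E; have : L \in (ctxD G1 G2 x : mtype) by rewrite -E ctxDE ctx1E eqxx mset1D1.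
rewrite ctxDE => /msetDP[]/key[G' EG']; [left | right]; exists G' => //;
  apply: (@ctxD_inj (ctx1 x [mset L])); rewrite E EG' ?ctxDA //.
by rewrite -!ctxDA ctxDCA.
Qed.

(** Supports and multisets are finite, so a context is a finite sum of one-element contexts; the
    parts of a substitution that act as renamings are typed along this decomposition. *)
Lemma ctx_ind (P : tctx -> Prop) :
  P ctx0 -> (forall x L, P (ctx1 x [mset L])) ->
  (forall G D, P G -> P D -> P (ctxD G D)) -> forall G, P G.
Proof.
move=> P0 P1 PD G.
have -> : G = \big[ctxD/ctx0]_(x <- finsupp G) ctx1 x (G x).
  apply/fsfunP => y.
  rewrite (big_morph (fun D : tctx => D y) (fun D D' => ctxDE D D' y) (ctx0E y)).
  have [y_in|y_notin] := boolP (y \in finsupp G).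
    rewrite (bigD1_seq y) ?fset_uniq //= ctx1E eqxx big1 ?msetD0 // => x.
    by rewrite ctx1E eq_sym => /negPf->.
  rewrite fsfun_dflt // big1_seq // => x /= x_in; rewrite ctx1E.
  by case: eqP => // Eyx; rewrite Eyx x_in in y_notin.
apply: big_ind => // x _; elim/mset_ind: (G x) => [|L M PM].
  by rewrite ctx1_0.
by rewrite ctx1D; apply: PD.
Qed.

(** * Typing indexed by size *)

(* Size-indexed typing with binary context sums: values are typed one linear  *)
(* type at a time, so that splitting the context of a value is immediate.      *)
Inductive typed : nat -> tctx -> term -> mtype -> Prop :=
| Typed_nil v : is_value v -> typed 0 ctx0 v mset0
| Typed_cons n m G D v L M :
    vtyped n G v L -> typed m D v M -> typed (n + m) (ctxD G D) v (L +` M)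
| Typed_app n m G D t u M N :
    typed n G t [mset (M --o N)] -> typed m D u M ->
    typed (n + m + 1) (ctxD G D) (App t u) N
with vtyped : nat -> tctx -> term -> ltype -> Prop :=
| VTyped_var x L : vtyped 0 (ctx1 x [mset L]) (Var x) L
| VTyped_lam n G t M N :
    typed n (ctx_cons M G) t N -> vtyped n G (Lam t) (M --o N).

Scheme typed_mind := Induction for typed Sort Prop
with vtyped_mind := Induction for vtyped Sort Prop.
Combined Scheme typed_vtyped_ind from typed_mind, vtyped_mind.

Lemma vtyped_value n G v L : vtyped n G v L -> is_value v.
Proof. by case. Qed.

Lemma typed_ax x M : typed 0 (ctx1 x M) (Var x) M.
Proof.
elim/mset_ind: M => [|L M IH]; first by rewrite ctx1_0; constructor.
by rewrite ctx1D; apply: (Typed_cons (VTyped_var x L)).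
Qed.

Lemma typed_lam n (m : 'I_n -> nat) (G : 'I_n -> tctx) (M N : 'I_n -> mtype) t :
  (forall k, typed (m k) (ctx_cons (M k) (G k)) t (N k)) ->
  typed (\sum_(k < n) m k) (\big[ctxD/ctx0]_(k < n) G k) (Lam t)
        (\big[@msetD ltype/mset0]_(k < n) [mset (M k --o N k)]).
Proof.
elim: n m G M N => [|n IHn] m G M N Ht; first by rewrite !big_ord0; constructor.
by rewrite !big_ord_recl; apply: Typed_cons; [constructor | apply: IHn].
Qed.

Lemma derivation_typed G t M (d : derivation G t M) :
  typed (derivation_size d) G t M.
Proof.
elim: d => [x {}M|{}G D {}t u {}M N d1 IH1 d2 IH2|n {}G {}M N {}t d IH] /=.
- exact: typed_ax.
- exact: Typed_app IH1 IH2.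
- exact: typed_lam.
Qed.

Lemma mset1_inj (L L' : ltype) (M : mtype) :
  L +` M = [mset L'] -> L = L' /\ M = mset0.
Proof.
move=> E; have L_in : L \in [mset L'] by rewrite -E mset1D1.
move: L_in E; rewrite in_mset1 => /eqP-> E; split=> //.
by apply: (can_inj (msetDKB [mset L'])); rewrite E msetD0.
Qed.

(** [Typed_cons] concludes a non-empty multiset and a value is no application, so only [Typed_nil]
    remains: an erased value contributes no size. *)
Lemma typed_mset0 n G v : is_value v -> typed n G v mset0 -> n = 0 /\ G = ctx0.
Proof.
move=> v_val; move EM: mset0 => M Hv.
by case: Hv v_val EM => // {}n m {}G D {}v L {}M _ _ _ /esym/mset1D_neq0.
Qed.

Lemma typed_mset1 n G v L : is_value v -> typed n G v [mset L] -> vtyped n G v L.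
Proof.
move=> v_val; move EM: [mset L] => M Hv.
case: Hv v_val EM => // [v' _ _|{}n m {}G D {}v L' {}M HL HM v_val].
  by move=> /esym E; case: (@mset1D_neq0 L mset0); rewrite msetD0.
move=> /esym/mset1_inj[<- EM]; rewrite EM in HM.
by have [-> ->] := typed_mset0 v_val HM; rewrite addn0 ctxD0.
Qed.

Lemma typed_lamP n G t M N :
  typed n G (Lam t) [mset (M --o N)] -> typed n (ctx_cons M G) t N.
Proof.
move/typed_mset1 => /(_ isT); move Ev: (Lam t) => v; move EL: (M --o N) => L Hv.
by case: Hv Ev EL => // {}n {}G t' M' N' Ht [->] /arrow_inj[-> ->].
Qed.

Lemma typed_appP n G t u N : typed n G (App t u) N ->
  exists n1 n2 G1 G2 M, [/\ n = n1 + n2 + 1, G = ctxD G1 G2,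
    typed n1 G1 t [mset (M --o N)] & typed n2 G2 u M].
Proof.
move Es: (App t u) => s Hs; case: Hs Es => [v +|{}n m {}G D v L M /vtyped_value|].
- by case: v.
- by case: v.
- by move=> {}n m {}G D t' u' M {}N Ht Hu [-> ->]; exists n, m, G, D, M.
Qed.

(** * Typed substitutions *)

(* [styped s n D G]: for each linear type [L] in [G x], counted with           *)
(* multiplicity, [s x : L]; the contexts of these typings add up to [D] and    *)
(* their sizes to [n].                                                         *)
Inductive styped (s : nat -> term) : nat -> tctx -> tctx -> Prop :=
| Styped_nil : styped s 0 ctx0 ctx0
| Styped_cons x n m D D' L G :
    vtyped n D (s x) L -> styped s m D' G ->
    styped s (n + m) (ctxD D D') (ctxD (ctx1 x [mset L]) G).

Lemma styped_ctx0 s n D : styped s n D ctx0 -> n = 0 /\ D = ctx0.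
Proof.
move EG: ctx0 => G Hs; case: Hs EG => // x {}n m {}D D' L {}G _ _ /esym.
by case/ctx1D_neq0.
Qed.

Lemma styped_split s n D G1 G2 : styped s n D (ctxD G1 G2) ->
  exists n1 n2 D1 D2, [/\ n = n1 + n2, D = ctxD D1 D2,
    styped s n1 D1 G1 & styped s n2 D2 G2].
Proof.
move EG: (ctxD G1 G2) => G Hs.
elim: Hs G1 G2 EG => [|x {}n m {}D D' L {}G Hx Hs IH] G1 G2.
  move=> /ctxD_eq0[-> ->]; exists 0, 0, ctx0, ctx0.
  by rewrite ctxD0; split=> //; constructor.
move=> /esym/ctx1_in_ctxD[] [G' -> EG];
  have [n1 [n2 [D1 [D2 [-> -> H1 H2]]]]] := IH _ _ (esym EG).
- exists (n + n1), n2, (ctxD D D1), D2; rewrite addnA ctxDA; split=> //.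
  exact: Styped_cons.
- exists n1, (n + n2), D1, (ctxD D D2); rewrite addnCA ctxDCA; split=> //.
  exact: Styped_cons.
Qed.

Lemma styped_add s n1 n2 D1 D2 G1 G2 :
  styped s n1 D1 G1 -> styped s n2 D2 G2 ->
  styped s (n1 + n2) (ctxD D1 D2) (ctxD G1 G2).
Proof.
elim=> [|x n m D D' L G Hx Hs IH] H2; first by rewrite !ctx0D.
by rewrite -addnA -!ctxDA; apply: Styped_cons (IH H2).
Qed.

Lemma styped_sum1 s n D x L :
  vtyped n D (s x) L -> styped s n D (ctx1 x [mset L]).
Proof.
move=> Hx; rewrite -[n]addn0 -[D]ctxD0 -[ctx1 _ _]ctxD0.
by apply: Styped_cons => //; constructor.
Qed.

Lemma styped_vtyped s n D x L :
  styped s n D (ctx1 x [mset L]) -> vtyped n D (s x) L.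
Proof.
move EG: (ctx1 x [mset L]) => G Hs; case: Hs EG => [|y {}n m {}D D' L' {}G Hy Hs].
  by move=> E; case: (@ctx1D_neq0 x L ctx0); rewrite ctxD0.
move=> E; have: ctxD (ctx1 y [mset L']) G y = ctx1 x [mset L] y by rewrite E.
rewrite ctxDE !ctx1E eqxx; case: eqP => [Exy|_ /mset1D_neq0//].
rewrite {}Exy in Hy E *; move=> /mset1_inj[EL _]; rewrite {}EL in Hy E *.
have EG : G = ctx0 by apply: (@ctxD_inj (ctx1 x [mset L])); rewrite -E ctxD0.
by move: Hs; rewrite EG => /styped_ctx0[-> ->]; rewrite addn0 ctxD0.
Qed.

Lemma styped_typed s n D x M :
  is_value (s x) -> typed n D (s x) M -> styped s n D (ctx1 x M).
Proof.
move Ev: (s x) => v v_val Hv.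
elim: Hv v_val Ev => // [v' _ _ _|{}n m {}G {}D v' L {}M HL _ IH v_val Ev].
  by rewrite ctx1_0; constructor.
by rewrite ctx1D; apply: Styped_cons (IH v_val Ev); rewrite Ev.
Qed.

(** * The substitution lemma *)

(* Satisfied by renamings, and then, since values can be shifted by renaming,  *)
(* by value substitutions: one substitution lemma serves both.                 *)
Definition liftable (P : (nat -> term) -> Prop) : Prop := forall s, P s ->
  [/\ P (up_subst s), forall x, is_value (s x) &
      forall x n D L, vtyped n D (s x) L ->
        vtyped n (ctx_cons mset0 D) (rename S (s x)) L].

(** The bound variable is mapped to itself, typed by axioms of size 0 whatever [M] is; the other
    images are shifted at unchanged size. *)
Lemma styped_up P s n D G M : liftable P -> P s -> styped s n D G ->
  styped (up_subst s) n (ctx_cons M D) (ctx_cons M G).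
Proof.
move=> liftP Ps Hs; rewrite !(ctx_cons_split M) -[n]add0n; apply: styped_add.
  by apply: styped_typed => //; apply: typed_ax.
elim: Hs => [|x {}n m {}D D' L {}G Hx _ IH].
  by rewrite ctx_cons0; constructor.
rewrite -[mset0]msetD0 !ctx_consD ctx_cons1; apply: Styped_cons => //.
by case: (liftP _ Ps) => _ _; apply.
Qed.

(** At each rule with two premises [styped_split] distributes the typings of the images, and an
    axiom receives exactly the one that replaces it. *)
Lemma subst_typed_vtyped P : liftable P ->
  (forall n G t M, typed n G t M -> forall s m D, P s -> styped s m D G ->
     typed (n + m) D (subst s t) M) /\
  (forall n G v L, vtyped n G v L -> forall s m D, P s -> styped s m D G ->
     vtyped (n + m) D (subst s v) L).
Proof.
move=> liftP.
apply: (@typed_vtyped_ind (fun n G t M _ => forall s m D, P s ->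
    styped s m D G -> typed (n + m) D (subst s t) M)
  (fun n G v L _ => forall s m D, P s ->
    styped s m D G -> vtyped (n + m) D (subst s v) L)).
- move=> v v_val s m D Ps /styped_ctx0[-> ->]; constructor.
  by case: v v_val => //= x _; case: (liftP _ Ps).
- move=> n k G D v L M _ IHL _ IHM s m D' Ps.
  case/styped_split=> [m1 [m2 [D1 [D2 [-> -> H1 H2]]]]].
  by rewrite addnACA; apply: Typed_cons; [apply: IHL | apply: IHM].
- move=> n k G D t u M N _ IHt _ IHu s m D' Ps.
  case/styped_split=> [m1 [m2 [D1 [D2 [-> -> H1 H2]]]]].
  rewrite addnAC addnACA /=.
  by apply: Typed_app; [apply: IHt | apply: IHu].
- by move=> x L s m D Ps /styped_vtyped.
- move=> n G t M N _ IH s m D Ps Hs; constructor.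
  have [Pup _ _] := liftP _ Ps.
  exact: IH _ _ _ Pup (styped_up _ liftP Ps Hs).
Qed.

Lemma rename_subst r s t : s =1 Var \o r -> rename r t = subst s t.
Proof.
elim: t r s => [x|t IH|t IHt u IHu] r s E /=; first by rewrite E.
- by congr Lam; apply: IH => -[|x] //=; rewrite E.
- by rewrite (IHt r s) ?(IHu r s).
Qed.

Lemma liftable_renaming : liftable (fun s => exists r, s =1 Var \o r).
Proof.
move=> s [r E]; split.
- by exists (up_ren r) => -[|x] //=; rewrite E.
- by move=> x; rewrite E.
- move=> x n D L; rewrite {}E /= => Hv.
  by inversion Hv; rewrite ctx_cons1; constructor.
Qed.

Lemma ctx_cons_morph0 : {morph ctx_cons mset0 : G D / ctxD G D}.
Proof. by move=> G D; rewrite -ctx_consD msetD0. Qed.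

Lemma styped_shift G : styped (Var \o S) 0 (ctx_cons mset0 G) G.
Proof.
elim/ctx_ind: G => [|x L|G D HG HD].
- by rewrite ctx_cons0; constructor.
- by apply: styped_sum1; rewrite ctx_cons1; constructor.
- by rewrite ctx_cons_morph0 -[0]addn0; apply: styped_add.
Qed.

Lemma shift_typed n G t M :
  typed n G t M -> typed n (ctx_cons mset0 G) (rename S t) M.
Proof.
move=> Ht; rewrite (@rename_subst S (Var \o S)) // -[n]addn0.
apply: (proj1 (subst_typed_vtyped liftable_renaming)) Ht _ _ _ _ (styped_shift G).
by exists S.
Qed.

Lemma is_value_rename r t : is_value (rename r t) = is_value t.
Proof. by case: t. Qed.

Lemma shift_vtyped n G v L :
  vtyped n G v L -> vtyped n (ctx_cons mset0 G) (rename S v) L.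
Proof.
move=> Hv; rewrite (@rename_subst S (Var \o S)) // -[n]addn0.
apply: (proj2 (subst_typed_vtyped liftable_renaming)) Hv _ _ _ _ (styped_shift G).
by exists S.
Qed.

Lemma liftable_value : liftable (fun s => forall x, is_value (s x)).
Proof.
move=> s Hs; split=> // [[|x] //=|x n D L]; first by rewrite is_value_rename.
exact: shift_vtyped.
Qed.

Lemma subst0_typed n m G D t v M N :
  is_value v -> typed n (ctx_cons M G) t N -> typed m D v M ->
  typed (n + m) (ctxD G D) (subst0 v t) N.
Proof.
move=> v_val Ht Hv.
apply: (proj1 (subst_typed_vtyped liftable_value)) Ht _ _ _ _ _; first by case.
(* The substitution consists of [v] at index 0, of size [m], and of lowered variables, typed by
   axioms of size 0. *)
rewrite ctx_cons_split ctxDC -[m]addn0; apply: styped_add.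
  exact: styped_typed.
set s := fun x => _; suff : styped s 0 G (ctx_cons mset0 G) by [].
elim/ctx_ind: G => [|x L|G1 G2 H1 H2].
- by rewrite ctx_cons0; constructor.
- by rewrite ctx_cons1; apply: styped_sum1; constructor.
- by rewrite ctx_cons_morph0 -[0]addn0; apply: styped_add.
Qed.

(** * Quantitative subject reduction *)

Lemma root_bv_typed n G t v N :
  is_value v -> typed n G (App (Lam t) v) N ->
  exists2 m, n = m.+1 & typed m G (subst0 v t) N.
Proof.
move=> v_val /typed_appP[n1 [n2 [G1 [G2 [M [-> -> Ht Hv]]]]]].
exists (n1 + n2); first by rewrite addn1.
exact: subst0_typed v_val (typed_lamP Ht) Hv.
Qed.

Lemma step_bv_typed C n G t v N :
  is_value v -> typed n G (plug C (App (Lam t) v)) N ->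
  exists2 m, n = m.+1 & typed m G (plug C (subst0 v t)) N.
Proof.
move=> v_val; elim: C n G N => [|u C IH|C IH f] n G N /=.
- exact: root_bv_typed.
- move=> /typed_appP[n1 [n2 [G1 [G2 [M [-> -> Hu HC]]]]]].
  have [m -> HC'] := IH _ _ _ HC; exists (n1 + m + 1); first by rewrite !addn1 addnS.
  exact: Typed_app Hu HC'.
- move=> /typed_appP[n1 [n2 [G1 [G2 [M [-> -> HC Hf]]]]]].
  have [m -> HC'] := IH _ _ _ HC; exists (m + n2 + 1); first by rewrite !addSn.
  exact: Typed_app HC' Hf.
Qed.

(** The typing of the argument is extracted as it is; the only rule lost is the (@) of the redex.
    The weakened context [C] does not use the new variable, so its terms are typed with [mset0] at
    index 0. *)
Lemma step_bi_typed C n G t (i : inert) N :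
  typed n G (plug C (App (Lam t) i)) N ->
  exists n1 n2 G1 G2 M, [/\ n = (n1 + n2).+1, G = ctxD G1 G2,
    typed n1 (ctx_cons M G1) (plug (rename_rctx S C) t) N & typed n2 G2 i M].
Proof.
elim: C n G N => [|u C IH|C IH f] n G N /= /typed_appP[n1 [n2 [G1 [G2 [M [-> -> H1 H2]]]]]].
- exists n1, n2, G1, G2, M; rewrite addn1; split=> //.
  exact: typed_lamP.
- have [m1 [m2 [D1 [D2 [M' [-> -> HC Hi]]]]]] := IH _ _ _ H2.
  exists (n1 + m1 + 1), m2, (ctxD G1 D1), D2, M'; split=> //.
  + by rewrite addn1 addnS addnA addn1.
  + by rewrite ctxDA.
  + rewrite -[M']mset0D ctx_consD; apply: Typed_app HC.
    exact: shift_typed.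
- have [m1 [m2 [D1 [D2 [M' [-> -> HC Hi]]]]]] := IH _ _ _ H1.
  exists (m1 + n2 + 1), m2, (ctxD D1 G2), D2, M'; split=> //.
  + by rewrite !addn1 addSn addnAC.
  + by rewrite ctxDAC.
  + rewrite -[M']msetD0 ctx_consD; apply: Typed_app HC _.
    exact: shift_typed.
Qed.

Inductive ptyped : nat -> tctx -> term -> env -> mtype -> Prop :=
| PTyped_nil n G t M : typed n G t M -> ptyped n G t [::] M
| PTyped_rcons n m G D t E (i : inert) M N :
    ptyped n (ctx_cons M G) t E N -> typed m D i M ->
    ptyped (n + m) (ctxD G D) t (rcons E i) N.

Lemma program_derivation_ptyped G p M (d : program_derivation G p M) :
  ptyped (program_derivation_size d) G p.1 p.2 M.
Proof.
elim: d => [{}G t {}M d|{}G D t E i {}M N d IH d'] /=.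
- exact/PTyped_nil/derivation_typed.
- exact: PTyped_rcons IH (derivation_typed d').
Qed.

(* [G'] is the context of the hole left by [t] in the program, so that the    *)
(* typing of [E] can be reused with any program typed in [G'].                *)
Lemma ptyped_split n G t E M : ptyped n G t E M ->
  exists n1 n2 G', [/\ n = n1 + n2, typed n1 G' t M &
    forall k t' E', ptyped k G' t' E' M -> ptyped (k + n2) G t' (E' ++ E) M].
Proof.
elim=> [{}n {}G {}t {}M Ht|{}n m {}G D {}t {}E i {}M N _ [n1 [n2 [G' [-> Ht IH]]]] Hi].
- exists n, 0, G; rewrite addn0; split=> // k t' E'.
  by rewrite addn0 cats0.
- exists n1, (n2 + m), G'; rewrite addnA; split=> // k t' E' /IH H.
  by rewrite addnA -rcons_cat; apply: PTyped_rcons H Hi.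
Qed.

Lemma step_bf_ptyped n G p q M : step_bf p q -> ptyped n G p.1 p.2 M ->
  exists2 m, n = m.+1 & ptyped m G q.1 q.2 M.
Proof.
case=> [] [C t u E] => [u_val|] /= /ptyped_split[n1 [n2 [G' [-> Ht Hk]]]].
- have [m -> Ht'] := step_bv_typed u_val Ht; exists (m + n2) => //.
  exact: Hk (PTyped_nil Ht').
- have [m1 [m2 [D1 [D2 [M' [-> EG HC Hi]]]]]] := step_bi_typed Ht.
  (* With [[:: u]] in place of the empty environment, the new entry lands in front of [E]. *)
  exists (m1 + m2 + n2) => //; apply: (Hk _ _ [:: u]); rewrite EG.
  exact: (PTyped_rcons (E := [::]) (PTyped_nil HC) Hi).
Qed.

(** * Normal forms and their size *)

Lemma inertW (i : inert) : is_fireball i.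
Proof. by rewrite /is_fireball inertP orbT. Qed.

Lemma is_fireball_app t u :
  is_fireball (App t u) =
  [&& is_fireball t, is_fireball u & if t is Lam _ then false else true].
Proof. by case: t => [x|t|t1 t2]; rewrite /is_fireball /= ?andbF ?andbT. Qed.

Lemma fireball_no_redex C t u : is_fireball (plug C (App (Lam t) u)) = false.
Proof.
elim: C => [|s C IH|C IH f] /=; rewrite is_fireball_app ?andbF //.
- by rewrite IH andbF.
- by rewrite IH.
Qed.

Lemma fireball_normal t E : is_fireball t -> normal (t, E).
Proof.
suff redex p q : step_bf p q -> is_fireball p.1 = false.
  by move=> Ht [q /redex]; rewrite Ht.
by case=> -[*]; apply: fireball_no_redex.
Qed.

Lemma progress t E : ~~ is_fireball t -> exists q, step_bf (t, E) q.
Proof.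
suff redex : ~~ is_fireball t -> exists C s u,
    is_fireball u /\ t = plug C (App (Lam s) u).
  move=> /redex[C [s [u [/orP[u_val|u_inert] ->]]]].
    by eexists; left; apply: Step_bv.
  by eexists; right; apply: (Step_bi C s (Inert u_inert)).
elim: t => [x|t _|t IHt u IHu] //.
(* The argument is examined first, as [CtxL] requires a fireball on its right. *)
have [Hu|Hu _] := boolP (is_fireball u); last first.
  by have [C [s [w [Hw ->]]]] := IHu Hu; exists (CtxR t C), s, w.
have [Ht|Ht _] := boolP (is_fireball t); last first.
  by have [C [s [w [Hw ->]]]] := IHt Ht; exists (CtxL C (Fireball Hu)), s, w.
(* Both sides being fireballs, only an abstraction on the left keeps the application from being
   one. *)
rewrite is_fireball_app Ht Hu /=; case: t {IHt} Ht => // s _ _.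
by exists Hole, s, u.
Qed.

(** Only applications outside abstractions count, and each of them is typed by exactly one (@) rule,
    since only values are typed by a sum of linear typings. *)
Lemma fireball_size n G t M : is_fireball t -> typed n G t M -> term_size t <= n.
Proof.
elim: t n G M => [x|t _|t IHt u IHu] n G M //=.
rewrite is_fireball_app => /and3P[Ht Hu _].
move=> /typed_appP[n1 [n2 [G1 [G2 [N [-> _ H1 H2]]]]]].
by rewrite leq_add2r leq_add ?(IHt _ _ _ Ht H1) ?(IHu _ _ _ Hu H2).
Qed.

Lemma fireball_program_size n G t E M :
  is_fireball t -> ptyped n G t E M -> program_size (t, E) <= n.
Proof.
move=> + H; elim: H => [{}n {}G {}t {}M H|{}n m {}G D {}t {}E i {}M N _ IH Hi] Ht.
- exact: fireball_size Ht H.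
- by rewrite program_size_rcons leq_add ?IH ?(fireball_size (inertW i) Hi).
Qed.

Theorem theorem2 (p : program) (G : tctx) (M : mtype)
    (d : program_derivation G p M) :
  exists (q : program) (e : evaluation p q),
    normal q /\ eval_length e + program_size q <= program_derivation_size d.
Proof.
have := program_derivation_ptyped d; move: (program_derivation_size d) => n.
elim/ltn_ind: n p {d} => n IH [t E] /= Hp.
have [Ht|/(progress E)[q Hq]] := boolP (is_fireball t).
  exists (t, E), (Eval_nil _); split; first exact: fireball_normal.
  exact: fireball_program_size Ht Hp.
(* The step adds one to the length and takes one from the size, so the bound for [m] gives the one
   for [m.+1]. *)
have [m En Hm] := step_bf_ptyped Hq Hp; rewrite {}En in IH *.
have [r [e [r_normal le_r]]] := IH m (ltnSn m) q Hm.
by exists r, (Eval_cons Hq e).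
Qed.
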